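(* Assume that for every group $g\in\mathcal G$, $U_g(t_g^{\max})\ge U_g^\star>0$. For each $g\in\mathcal G$, let $\hat U_g^-(t,\alpha)$ be a point-wise lower confidence bound on $U_g(t)$, i.e. a random quantity with $\Pr\big(U_g(t)\ge \hat U_g^-(t,\alpha)\big)\ge 1-\alpha$ for every $t\in\{0,1,\dots,t_g^{\max}-1\}$ and every $\alpha\in(0,1)$. Define $$\hat t_g^{\mathrm{union}} := \min\Big\{t\in\{1,\dots,t_g^{\max}-1\} : \hat U_g^-\Big(t,\tfrac{\alpha}{t_g^{\max}-1}\Big)\ge U_g^\star\Big\},$$ where the minimum over the empty set is defined to be $t_g^{\max}$. Then for any group $g\in\mathcal G$ and any $\alpha\in(0,1)$, with probability at least $1-\alpha$, $$U_g\big(\hat t_g^{\mathrm{union}}\big)\ge U_g^\star .$$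
   Context: There are $n$ items $d^1,\dots,d^n$ in an item space $\mathcal D$, and a family $\mathcal G$ of (possibly overlapping) groups of items. A recommendation request is a pair $(q,\mathbf r)$ drawn from a distribution $P_{Q,\mathbf R}$, where $q\in\mathcal Q$ is a query and $\mathbf r=(r^1,\dots,r^n)\in\{0,1\}^n$ is the vector of relevances of the items. A relevance model $f:\mathcal Q\times\mathcal D\to[0,1]$ is fixed. For a query $q$ and group $g$, $\sigma_{q,g}^f$ is a deterministic ranking of the items of $g$ by decreasing value of $f(q,\cdot)$; $\sigma_{q,g}^f(j)$ is the index of the item of $g$ ranked at position $j$. For each $g$, $t_g^{\max}\ge 1$ is an integer (at most the number of items in $g$) and $U_g^\star\in\mathbb R$ is a target. For $t\in\{0,1,\dots,t_g^{\max}\}$, $$U_g(t):=\mathbb E_{(q,\mathbf r)\sim P_{Q,\mathbf R}}\Big[\sum_{j=1}^{t} r^{\sigma_{q,g}^f(j)}\Big]$$ is the expected number of relevant items among the $t$ top-scored items of $g$. In $U_g(\hat t)$ with $\hat t$ random, the deterministic function $U_g$ is evaluated at the random integer $\hat t$; probabilities are over the randomness of the confidence bounds (computed from random data). *)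

(* Defs.v *)
From HB Require Import structures.
From mathcomp Require Import all_boot all_order all_algebra.
From mathcomp Require Import all_classical all_reals all_analysis.

Set Implicit Arguments.
Unset Strict Implicit.
Unset Printing Implicit Defensive.

Import Order.TTheory GRing.Theory Num.Theory.

Local Open Scope classical_set_scope.
Local Open Scope ring_scope.

(* Positions are 0-based: [s j] is the item at the (j+1)-th place.  Ties in
   [score] may be broken in any way. *)
Definition is_ranking (R : realType) (n : nat) (score : 'I_n -> R)
    (A : {set 'I_n}) (s : 'I_#|A| -> 'I_n) : Prop :=
  [/\ injective s,
      (forall j, s j \in A) &
      (forall j k : 'I_#|A|, (j <= k)%N -> score (s k) <= score (s j))].

Definition relevant_in_top (R : realType) (n m : nat) (s : 'I_m -> 'I_n)
    (t : nat) (r : n.-tuple bool) : R :=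
  \sum_(j < m | (j < t)%N) (tnth r (s j))%:R.

(* Extended-real valued, as the library's expectation is; the integrand takes
   values in [0, t], so the value is finite. *)
Definition expected_relevant (R : realType) (n m : nat) (dQ : measure_display)
    (Q : measurableType dQ) (P : probability (Q * n.-tuple bool)%type R)
    (s : Q -> 'I_m -> 'I_n) (t : nat) : \bar R :=
  ('E_P[fun qr => relevant_in_top R (s qr.1) t qr.2])%E.

Definition pointwise_lower_bound (R : realType) (dO : measure_display)
    (Omega : measurableType dO) (Pr : probability Omega R)
    (U : nat -> \bar R) (tmax : nat)
    (Uhat : nat -> R -> {RV Pr >-> R}) : Prop :=
  forall (t : nat) (alpha : R), (t < tmax)%N -> 0 < alpha -> alpha < 1 ->
    ((1 - alpha)%:E <= Pr [set w | (Uhat t alpha w)%:E <= U t])%E.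

(* Every index of the range is below [tmax], so starting the iterated minimum
   from [tmax] only matters when no index qualifies, where it gives [tmax]. *)
Definition t_union (R : realType) (tmax : nat) (Ustar alpha : R)
    (L : nat -> R -> R) : nat :=
  \big[minn/tmax]_(1 <= t < tmax | Ustar <= L t (alpha / (tmax.-1)%:R)) t.

(* Main.v *)
(* If all the tmax - 1 lower bounds at levels 1, ..., tmax - 1 hold at once,
   then either the selected index is tmax, whose utility reaches the target by
   hypothesis, or it is some t with Ustar <= Uhat t <= U t.  The bounds hold
   simultaneously except with probability (tmax - 1) * (alpha / (tmax - 1)).
   The success event is measurable because the selected index is a function of
   finitely many measurable tests. *)
Require Import Defs.
From HB Require Import structures.
From mathcomp Require Import all_boot all_order all_algebra.
From mathcomp Require Import all_classical all_reals all_analysis.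
From mathcomp Require Import measurable_realfun.

Set Implicit Arguments.
Unset Strict Implicit.
Unset Printing Implicit Defensive.

Import Order.TTheory GRing.Theory Num.Theory.

Local Open Scope classical_set_scope.
Local Open Scope ring_scope.


(** Since [minn] returns one of its arguments, the iterated minimum is the default [m] or an index
    that passed the test [p]. *)
Lemma bigminn_filter_mem (s : seq nat) (p : pred nat) (m : nat) :
  \big[minn/m]_(t <- s | p t) t = m \/
  exists t, [/\ t \in s, p t & \big[minn/m]_(t <- s | p t) t = t].
Proof.
elim: s => [|t s IH]; first by left; rewrite big_nil.
rewrite big_cons.
have {}IH : \big[minn/m]_(j <- s | p j) j = m \/
    exists u, [/\ u \in t :: s, p u & \big[minn/m]_(j <- s | p j) j = u].
  case: IH => [->|[u [us pu ->]]]; [by left | right; exists u].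
  by rewrite in_cons us orbT.
case: ifPn => // pt; rewrite /minn; case: ifPn => // _.
by right; exists t; rewrite mem_head.
Qed.

(** Induction on [s], splitting on the head test. Where it passes, the condition on the remaining
    minimum [k] becomes [B (minn t k)], so the induction must range over all [B]. *)
Lemma measurable_bigminn_filter (dO : measure_display)
    (Omega : measurableType dO) (s : seq nat) (p : nat -> Omega -> bool)
    (m : nat) (B : set nat) :
  (forall t, t \in s -> measurable [set w | p t w]) ->
  measurable [set w | B (\big[minn/m]_(t <- s | p t w) t)].
Proof.
elim: s B => [|t s IH] B mp.
  under eq_set do rewrite big_nil.
  have [Bm|nBm] := pselect (B m).
    by rewrite (_ : [set _ | _] = setT)//; apply/seteqP; split.
  by rewrite (_ : [set _ | _] = set0)//; apply/seteqP; split.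
have mt : measurable [set w | p t w] by apply: mp; rewrite mem_head.
have {}IH C : measurable [set w | C (\big[minn/m]_(j <- s | p j w) j)].
  by apply: IH => j js; apply: mp; rewrite in_cons js orbT.
rewrite (_ : [set _ | _] =
    ([set w | p t w] `&`
       [set w | [set k | B (minn t k)] (\big[minn/m]_(j <- s | p j w) j)]) `|`
    (~` [set w | p t w] `&` [set w | B (\big[minn/m]_(j <- s | p j w) j)])).
  apply: measurableU; apply: measurableI; [exact: mt | exact: IH | | exact: IH].
  exact: measurableC.
apply/seteqP; split => w /=; rewrite big_cons; case: ifPn => pw;
  [by left|by right| |].
- by case=> -[].
- by case=> -[]//; rewrite (negbTE pw).
Qed.

(** Boole's inequality applied to the complements: each [~] A
    i[has probability at most]delta[, and together they cover]~[T]. No independence is involved. *)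
Lemma probability_ge_union_bound (R : realType) (dO : measure_display)
    (Omega : measurableType dO) (Pr : probability Omega R)
    (k : nat) (A : nat -> set Omega) (T : set Omega) (delta : R) :
  (forall i, (i < k)%N -> measurable (A i)) -> measurable T ->
  (forall i, (i < k)%N -> ((1 - delta)%:E <= Pr (A i))%E) ->
  (forall w, (forall i, (i < k)%N -> A i w) -> T w) ->
  ((1 - k%:R * delta)%:E <= Pr T)%E.
Proof.
move=> mA mT PA AT.
have PCE B e : measurable B -> (Pr (~` B) <= e%:E)%E = ((1 - e)%:E <= Pr B)%E.
  move=> mB; rewrite probability_setC// -(fineK (fin_num_measure Pr _ mB)).
  by rewrite -EFinB !lee_fin lerBlDl lerBlDr.
rewrite -PCE//.
apply: (@le_trans _ _ (Pr (\big[setU/set0]_(i < k) ~` A i))).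
  apply: le_measure; rewrite ?inE.
  - exact: measurableC.
  - by apply: bigsetU_measurable => i _; apply: measurableC; exact: mA.
  (* Contrapositive of [AT]: a point outside [T] must violate some [A i]. *)
  - move=> w nTw; rewrite -(bigcup_mkord k (fun i => ~` A i)).
    apply: contrapT => nA; apply: nTw.
    apply: AT => i ik; apply: contrapT => nAi; apply: nA.
    by exists i.
apply: (le_trans (Boole_inequality Pr (A := fun i => ~` A i) _)).
  by move=> i ik; apply: measurableC; exact: mA.
rewrite [leRHS](_ : _ = (\sum_(i < k) delta%:E)%E); last first.
  by rewrite sumEFin sumr_const card_ord mulr_natl.
by apply: lee_sum => i _; rewrite PCE ?PA//; exact: mA.
Qed.

Theorem theorem4p1 (R : realType)
    (n : nat) (D : Type) (d : 'I_n -> D)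
    (G : Type) (items : G -> {set 'I_n})
    (dQ : measure_display) (Q : measurableType dQ)
    (P : probability (Q * n.-tuple bool)%type R)
    (f : Q -> D -> R)
    (hf : forall q x, 0 <= f q x /\ f q x <= 1)
    (sigma : Q -> forall g : G, 'I_#|items g| -> 'I_n)
    (hsigma : forall q g,
      is_ranking (fun i => f q (d i)) (A := items g) (sigma q g))
    (tmax : G -> nat)
    (htmax : forall g, (1 <= tmax g)%N /\ (tmax g <= #|items g|)%N)
    (hmeas : forall g t, (t <= tmax g)%N ->
      measurable_fun [set: (Q * n.-tuple bool)%type]
        (fun qr => relevant_in_top R (sigma qr.1 g) t qr.2))
    (Ustar : G -> R)
    (hUstar : forall g, 0 < Ustar g /\
      ((Ustar g)%:E <= expected_relevant P (fun q => sigma q g) (tmax g))%E)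
    (dO : measure_display) (Omega : measurableType dO)
    (Pr : probability Omega R)
    (Uhat : G -> nat -> R -> {RV Pr >-> R})
    (hUhat : forall g,
      pointwise_lower_bound (expected_relevant P (fun q => sigma q g))
        (tmax g) (Uhat g)) :
  forall (g : G) (alpha : R), 0 < alpha -> alpha < 1 ->
    ((1 - alpha)%:E <=
      Pr [set w | (Ustar g)%:E <=
        expected_relevant P (fun q => sigma q g)
          (t_union (tmax g) (Ustar g) alpha (fun t a => Uhat g t a w))])%E.
Proof.
move=> g alpha a0 a1.
have [tmax0 _] := htmax g; have [_ UstarT] := hUstar g.
set U := expected_relevant P _ in UstarT *.
have hU : pointwise_lower_bound U (tmax g) (Uhat g) := hUhat g.
(* If [tmax g] is 1, the divisor is 0 and [a] is 0 by convention; there are then no bounds to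
   combine. *)
pose a : R := alpha / (tmax g).-1%:R.
pose X t : Omega -> R := Uhat g t a.
have mX t : measurable_fun setT (fun w => (X t w)%:E).
  exact/measurable_EFinP.
have m_qualifies t : measurable [set w | Ustar g <= X t w].
  rewrite -[Y in measurable Y]setTI.
  by under eq_set do rewrite -lee_fin; exact: measurable_lee.
set T := [set w | _].
(* [U] is deterministic, so [T] says that the selected index lies in a fixed set of integers. *)
have mT : measurable T.
  exact: (@measurable_bigminn_filter _ _ (index_iota 1 (tmax g))
    (fun t w => Ustar g <= X t w) (tmax g) [set k | ((Ustar g)%:E <= U k)%E]).
(* The shift [i.+1] matches the levels 1, ..., [tmax g] - 1 with the indices below [(tmax g).-1] of
   the union bound. *)
have T_of_bounds w :
    (forall i, (i < (tmax g).-1)%N -> ((X i.+1 w)%:E <= U i.+1)%E) -> T w.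
  move=> XU; rewrite /T/= /t_union.
  have [->//|[t [+ Ut ->]]] := bigminn_filter_mem (index_iota 1 (tmax g))
    (fun t => Ustar g <= X t w) (tmax g).
  rewrite mem_index_iota => /andP[]; case: t Ut => // t Ut _ ttmax.
  apply: (@le_trans _ _ (X t.+1 w)%:E); first by rewrite lee_fin.
  by apply: XU; rewrite -ltnS prednK.
have PX i : (i < (tmax g).-1)%N ->
    ((1 - a)%:E <= Pr [set w | ((X i.+1 w)%:E <= U i.+1)%E])%E.
  (* The mere existence of [i] makes the divisor at least 1, whence 0 < [a] <= [alpha] < 1, an
     admissible confidence level. *)
  move=> i_lt; have k0 : (0 < (tmax g).-1)%N by apply: leq_ltn_trans i_lt.
  apply: hU; first by rewrite -ltnS prednK in i_lt.
    by rewrite divr_gt0 ?ltr0n.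
  by rewrite ltr_pdivrMr ?ltr0n// mul1r (lt_le_trans a1)// ler1n.
have mXU i : (i < (tmax g).-1)%N ->
    measurable [set w | ((X i.+1 w)%:E <= U i.+1)%E].
  by move=> _; rewrite -[Y in measurable Y]setTI; exact: measurable_lee.
apply: le_trans (probability_ge_union_bound mXU mT PX T_of_bounds).
rewrite lee_fin lerD2l lerN2 /a.
(* The total error is 0 when there are no bounds, and exactly [alpha] otherwise. *)
have [->|k0] := eqVneq (tmax g).-1 0%N; first by rewrite mul0r ltW.
by rewrite mulrC divfK// pnatr_eq0.
Qed.
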